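(* Let $k$ be a field. Suppose that a full sub-2-category $\mathcal C\subseteq\mathrm{LCat}_k$ has ambidextrous adjoints and that each category in $\mathcal C$ comes equipped with a trace. Then the formula $\Psi(\varphi)=\varphi^t$ equips $\mathcal C$ with an even-handed structure.
   Context: $\mathrm{LCat}_k$ is the 2-category of $k$-linear categories (enriched in finite-dimensional $k$-vector spaces), linear functors and natural transformations. **Trace.** A trace on a $k$-linear category is a linear map $\mathrm{Tr}_x:\mathrm{End}(x)\to k$ for each object $x$ that is nondegenerate ($s:\mathrm{Hom}(x,y)\to\mathrm{Hom}(y,x)^\vee$, $f\mapsto(g\mapsto\mathrm{Tr}_x(gf))$, is an isomorphism for all $x,y$) and cyclic ($\mathrm{Tr}_x(gf)=\mathrm{Tr}_y(fg)$ for $f:x\to y$, $g:y\to x$). (If the hom-sets carry a $\mathbb Z$-grading, cyclicity is replaced by graded commutativity $\mathrm{Tr}(gf)=(-1)^{\deg f\deg g}\mathrm{Tr}(fg)$, and adjunction isomorphisms preserve the grading.) **Transpose.** If $F:A\to B$ is linear with right adjoint $F^*$ and adjunction isomorphisms $\varphi:\mathrm{Hom}(Fx,y)\to\mathrm{Hom}(x,F^*y)$, then $\varphi^t=s_B^{-1}\circ\varphi^\vee\circ s_A:\mathrm{Hom}(F^*y,x)\to\mathrm{Hom}(y,Fx)$; equivalently $\varphi^t(g)$ is the unique morphism with $\mathrm{Tr}_y(f\varphi^t(g))=\mathrm{Tr}_{F^*y}(\varphi(f)g)$ for all $f:Fx\to y$. **Even-handed structure.** In a 2-category, for $F:A\to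 B$ with right adjoint $F^*$, let $\mathrm{Adj}(F\dashv F^* )$ be the set of pairs $(\eta:\mathrm{id}_A\Rightarrow F^*F,\ \epsilon:FF^*\Rightarrow\mathrm{id}_B)$ satisfying the triangle identities. The 2-category has ambidextrous adjoints if every 1-morphism has an adjoint and all adjoints are two-sided. An even-handed structure then consists of a map $\Psi:\mathrm{Adj}(F\dashv F^* )\to\mathrm{Adj}(F^*\dashv F)$ for each pair of adjoint 1-morphisms such that (i) $\Psi^2=\mathrm{id}$; (ii) $\Psi$ sends the composite adjunction $GF\dashv F^*G^*$ of two adjunctions to the composite of their images under $\Psi$, and fixes the trivial adjunction on each identity morphism; (iii) for every $\theta:F\Rightarrow G$ and all choices of right adjoints, $(F^*\epsilon_G)\circ(F^*\theta G^* )\circ(\eta_FG^* )=(\epsilon'_GF^* )\circ(G^*\theta F^* )\circ(G^*\eta'_F):G^*\Rightarrow F^*$, where $(\eta'_F,\epsilon'_F)=\Psi(\eta_F,\epsilon_F)$ and $(\eta'_G,\epsilon'_G)=\Psi(\eta_G,\epsilon_G)$. For categories, elements of $\mathrm{Adj}(F\dashv F^* )$ are identified with natural adjunction isomorphisms $\varphi:\mathrm{Hom}(Fx,y)\to\mathrm{Hom}(x,F^*y)$ by $\varphi(f)=F^*(f)\circ\eta_x$, $\varphi^{-1}(g)=\epsilon_y\circ F(g)$, and $\Psi$ is expressed accordingly. *)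

(* Defs.v *)
From HB Require Import structures.
From mathcomp Require Import all_boot all_order all_algebra.

Set Implicit Arguments.
Unset Strict Implicit.
Unset Printing Implicit Defensive.

Import GRing.Theory.
Local Open Scope ring_scope.

Declare Scope lcat_scope.
Delimit Scope lcat_scope with LC.
Local Open Scope lcat_scope.

(* Composition is in applicative order: [comp g f], written [g ;o f], is      *)
(* "g after f".  Finite-dimensionality of hom-spaces is part of [vectType].   *)
Record lcat (k : fieldType) := LCat {
  obj :> Type;
  hom : obj -> obj -> vectType k;
  idm : forall x, hom x x;
  comp : forall x y z, {bilinear hom y z -> hom x y -> hom x z};
  comp1m : forall x y (f : hom x y), comp x y y (idm y) f = f;
  compm1 : forall x y (f : hom x y), comp x x y f (idm x) = f;
  compA : forall x y z w (h : hom z w) (g : hom y z) (f : hom x y),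
    comp x z w h (comp x y z g f) = comp x y w (comp y z w h g) f
}.

Arguments hom {k l} x y : rename.
Arguments idm {k l} x : rename.
Arguments comp {k l x y z} : rename.

Notation "g ;o f" := (comp g f)
  (at level 40, left associativity) : lcat_scope.

Record lfunctor (k : fieldType) (A B : lcat k) := LFunctor {
  fobj :> A -> B;
  fmap : forall x y, {linear hom x y -> hom (fobj x) (fobj y)};
  fmap1 : forall x, fmap x x (idm x) = idm (fobj x);
  fmapM : forall x y z (g : hom y z) (f : hom x y),
    fmap x z (g ;o f) = fmap y z g ;o fmap x y f
}.

Arguments fmap {k A B} l {x y} : rename.

Section FunctorOps.
Variable k : fieldType.

Definition id_functor (A : lcat k) : lfunctor A A :=
  {| fobj := fun x => x;
     fmap := fun x y => idfun : {linear hom x y -> hom x y};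
     fmap1 := fun x => erefl;
     fmapM := fun x y z g f => erefl |}.

Variables (A B D : lcat k) (G : lfunctor B D) (F : lfunctor A B).

Fact comp_fmap1 (x : A) : fmap G (fmap F (idm x)) = idm (G (F x)).
Proof. by rewrite !fmap1. Qed.

Fact comp_fmapM (x y z : A) (g : hom y z) (f : hom x y) :
  fmap G (fmap F (g ;o f)) = fmap G (fmap F g) ;o fmap G (fmap F f).
Proof. by rewrite !fmapM. Qed.

Definition comp_functor : lfunctor A D :=
  {| fobj := fun x => G (F x);
     fmap := fun x y => fmap G \o fmap F : {linear hom x y -> hom (G (F x)) (G (F y))};
     fmap1 := comp_fmap1;
     fmapM := comp_fmapM |}.

End FunctorOps.

Notation "G \oF F" := (comp_functor G F)
  (at level 40, left associativity) : lcat_scope.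

Record nat_trans (k : fieldType) (A B : lcat k) (F G : lfunctor A B) := NatTrans {
  component :> forall x : A, hom (F x) (G x);
  naturality : forall (x y : A) (f : hom x y),
    component y ;o fmap F f = fmap G f ;o component x
}.

(* [adj F Fs] is Adj(F -| Fs), with Fs the right adjoint.  Here and below,    *)
(* equations of 2-cells are stated on components: the structural 2-cells      *)
(* identifying, say, (H \oF G) \oF F with H \oF (G \oF F) are identities      *)
(* there, and whiskering is G alpha = (fmap G (alpha x))_x and                *)
(* alpha F = (alpha (F x))_x.                                                 *)
Record adj (k : fieldType) (A B : lcat k)
    (F : lfunctor A B) (Fs : lfunctor B A) := Adj {
  unit : nat_trans (id_functor A) (Fs \oF F);
  counit : nat_trans (F \oF Fs) (id_functor B);
  triangle_l : forall x : A, counit (F x) ;o fmap F (unit x) = idm (F x);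
  triangle_r : forall y : B, fmap Fs (counit y) ;o unit (Fs y) = idm (Fs y)
}.

Section IdAdj.
Variables (k : fieldType) (A : lcat k).

Fact id_unit_nat (x y : A) (f : hom x y) :
  idm y ;o fmap (id_functor A) f
  = fmap (id_functor A \oF id_functor A) f ;o idm x.
Proof. by rewrite comp1m compm1. Qed.

Fact id_counit_nat (x y : A) (f : hom x y) :
  idm y ;o fmap (id_functor A \oF id_functor A) f
  = fmap (id_functor A) f ;o idm x.
Proof. by rewrite comp1m compm1. Qed.

Fact id_triangle (x : A) : idm x ;o idm x = idm x.
Proof. by rewrite comp1m. Qed.

Definition id_adj : adj (id_functor A) (id_functor A) :=
  {| unit := @NatTrans k A A (id_functor A) (id_functor A \oF id_functor A)
               (fun x => idm x) id_unit_nat;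
     counit := @NatTrans k A A (id_functor A \oF id_functor A) (id_functor A)
                 (fun x => idm x) id_counit_nat;
     triangle_l := id_triangle;
     triangle_r := id_triangle |}.

End IdAdj.

Section CompAdj.
Variables (k : fieldType) (A B D : lcat k).
Variables (F : lfunctor A B) (Fs : lfunctor B A) (aF : adj F Fs).
Variables (G : lfunctor B D) (Gs : lfunctor D B) (aG : adj G Gs).

Definition comp_unit_fun (x : A) : hom x (Fs (Gs (G (F x)))) :=
  fmap Fs (unit aG (F x)) ;o unit aF x.

Definition comp_counit_fun (z : D) : hom (G (F (Fs (Gs z)))) z :=
  counit aG z ;o fmap G (counit aF (Gs z)).

Fact comp_unit_nat (x y : A) (f : hom x y) :
  comp_unit_fun y ;o fmap (id_functor A) f
  = fmap ((Fs \oF Gs) \oF (G \oF F)) f ;o comp_unit_fun x.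
Proof.
rewrite /comp_unit_fun /= -compA.
have /= -> := naturality (unit aF) f.
rewrite !compA -fmapM.
have /= -> := naturality (unit aG) (fmap F f).
by rewrite fmapM.
Qed.

Fact comp_counit_nat (z w : D) (f : hom z w) :
  comp_counit_fun w ;o fmap ((G \oF F) \oF (Fs \oF Gs)) f
  = fmap (id_functor D) f ;o comp_counit_fun z.
Proof.
rewrite /comp_counit_fun /= -compA -fmapM.
have /= -> := naturality (counit aF) (fmap Gs f).
rewrite fmapM !compA.
by have /= -> := naturality (counit aG) f.
Qed.

Fact comp_triangle_l (x : A) :
  comp_counit_fun (G (F x)) ;o fmap (G \oF F) (comp_unit_fun x)
  = idm (G (F x)).
Proof.
rewrite /comp_counit_fun /comp_unit_fun /= -compA -fmapM (fmapM F) compA.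
have /= -> := naturality (counit aF) (unit aG (F x)).
by rewrite -compA triangle_l compm1 triangle_l.
Qed.

Fact comp_triangle_r (z : D) :
  fmap (Fs \oF Gs) (comp_counit_fun z) ;o comp_unit_fun (Fs (Gs z))
  = idm (Fs (Gs z)).
Proof.
rewrite /comp_counit_fun /comp_unit_fun /= compA -fmapM (fmapM Gs) -compA.
have /= <- := naturality (unit aG) (counit aF (Gs z)).
by rewrite compA triangle_r comp1m triangle_r.
Qed.

Definition comp_adj : adj (G \oF F) (Fs \oF Gs) :=
  {| unit := @NatTrans k A A (id_functor A) ((Fs \oF Gs) \oF (G \oF F))
               comp_unit_fun comp_unit_nat;
     counit := @NatTrans k D D ((G \oF F) \oF (Fs \oF Gs)) (id_functor D)
                 comp_counit_fun comp_counit_nat;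
     triangle_l := comp_triangle_l;
     triangle_r := comp_triangle_r |}.

End CompAdj.

Section AdjHom.
Variables (k : fieldType) (A B : lcat k).
Variables (F : lfunctor A B) (Fs : lfunctor B A) (a : adj F Fs).
Variables (x : A) (y : B).

Definition adj_hom : 'Hom(hom (F x) y, hom x (Fs y)) :=
  linfun (fun f : hom (F x) y => fmap Fs f ;o unit a x).

Definition adj_hom_inv : 'Hom(hom x (Fs y), hom (F x) y) :=
  linfun (fun g : hom x (Fs y) => counit a y ;o fmap F g).

End AdjHom.

(* A full sub-2-category of LCat_k is given by its class of objects: it       *)
(* contains all linear functors between them and all natural transformations. *)
Definition full_sub2cat (k : fieldType) := lcat k -> Prop.

Definition ob2 (k : fieldType) (C : full_sub2cat k) := {A : lcat k | C A}.
Definition ob2_lcat (k : fieldType) (C : full_sub2cat k) (A : ob2 C) : lcat k :=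
  sval A.
Coercion ob2_lcat : ob2 >-> lcat.

Definition ambidextrous (k : fieldType) (C : full_sub2cat k) : Prop :=
  (forall (A B : ob2 C) (F : lfunctor A B),
     exists Fs : lfunctor B A, inhabited (adj F Fs)) /\
  (forall (A B : ob2 C) (F : lfunctor A B) (Fs : lfunctor B A),
     inhabited (adj F Fs) -> inhabited (adj Fs F)).

Record even_handed (k : fieldType) (C : full_sub2cat k) := EvenHanded {
  Psi : forall (A B : ob2 C) (F : lfunctor A B) (Fs : lfunctor B A),
    adj F Fs -> adj Fs F;
  PsiK : forall (A B : ob2 C) (F : lfunctor A B) (Fs : lfunctor B A)
      (a : adj F Fs),
    Psi (Psi a) = a;
  Psi_id : forall A : ob2 C, Psi (id_adj A) = id_adj A;
  Psi_comp : forall (A B D : ob2 C)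
      (F : lfunctor A B) (Fs : lfunctor B A) (aF : adj F Fs)
      (G : lfunctor B D) (Gs : lfunctor D B) (aG : adj G Gs),
    Psi (comp_adj aF aG) = comp_adj (Psi aG) (Psi aF);
  Psi_nat : forall (A B : ob2 C) (F G : lfunctor A B) (theta : nat_trans F G)
      (Fs : lfunctor B A) (aF : adj F Fs)
      (Gs : lfunctor B A) (aG : adj G Gs) (y : B),
    fmap Fs (counit aG y) ;o fmap Fs (theta (Gs y)) ;o unit aF (Gs y)
    = counit (Psi aG) (Fs y) ;o fmap Gs (theta (Fs y)) ;o fmap Gs (unit (Psi aF) y)
}.

Section Pairing.
Variables (k : fieldType) (A : lcat k).
Variable Tr : forall x : A, {linear hom x x -> k^o}.

(* The map s : Hom(x,y) -> Hom(y,x)^v, f |-> (g |-> Tr_x (g f)). *)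
Definition trace_pairing (x y : A) : 'Hom(hom x y, 'Hom(hom y x, k^o)) :=
  linfun (fun f : hom x y =>
    linfun (fun g : hom y x => Tr x (g ;o f))).

End Pairing.

Record trace (k : fieldType) (A : lcat k) := Trace {
  Tr :> forall x : A, {linear hom x x -> k^o};
  Tr_nondegenerate : forall x y : A, bijective (trace_pairing Tr x y);
  Tr_cyclic : forall (x y : A) (f : hom x y) (g : hom y x),
    Tr x (g ;o f) = Tr y (f ;o g)
}.

Definition dual_lfun (k : fieldType) (U V : vectType k) (h : 'Hom(U, V)) :
    'Hom('Hom(V, k^o), 'Hom(U, k^o)) :=
  linfun (fun u : 'Hom(V, k^o) => (u \o h)%VF).

(* [s^-1] below is [inv_lfun], a genuine inverse since s is bijective. *)
Definition transpose (k : fieldType) (A B : lcat k) (trA : trace A) (trB : trace B)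
    (F : lfunctor A B) (Fs : lfunctor B A) (x : A) (y : B)
    (phi : 'Hom(hom (F x) y, hom x (Fs y))) : 'Hom(hom (Fs y) x, hom y (F x)) :=
  ((trace_pairing trB y (F x))^-1 \o dual_lfun phi
     \o trace_pairing trA (Fs y) x)%VF.

(* [linfun f] agrees with f only when f is linear; this is the case for each  *)
(* of its uses above.                                                         *)
Section Linearity.
Variable k : fieldType.

Lemma linfunE (U V : vectType k) (f : U -> V) : linear f -> linfun f =1 f.
Proof.
move=> lf u.
pose f' : {linear U -> V} := HB.pack f (GRing.isLinear.Build k U V *:%R f lf).
exact: (lfunE f').
Qed.

Lemma adj_homE (A B : lcat k) (F : lfunctor A B) (Fs : lfunctor B A)
    (a : adj F Fs) (x : A) (y : B) (f : hom (F x) y) :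
  adj_hom a x y f = fmap Fs f ;o unit a x.
Proof. by rewrite linfunE // => c u v; rewrite linearP linearPl. Qed.

Lemma adj_hom_invE (A B : lcat k) (F : lfunctor A B) (Fs : lfunctor B A)
    (a : adj F Fs) (x : A) (y : B) (g : hom x (Fs y)) :
  adj_hom_inv a x y g = counit a y ;o fmap F g.
Proof. by rewrite linfunE // => c u v; rewrite linearP linearPr. Qed.

Lemma adj_homK (A B : lcat k) (F : lfunctor A B) (Fs : lfunctor B A)
    (a : adj F Fs) (x : A) (y : B) :
  cancel (adj_hom a x y) (adj_hom_inv a x y).
Proof.
move=> f; rewrite adj_homE adj_hom_invE fmapM compA.
have /= -> := naturality (counit a) f.
by rewrite -compA triangle_l compm1.
Qed.

Lemma adj_hom_invK (A B : lcat k) (F : lfunctor A B) (Fs : lfunctor B A)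
    (a : adj F Fs) (x : A) (y : B) :
  cancel (adj_hom_inv a x y) (adj_hom a x y).
Proof.
move=> g; rewrite adj_homE adj_hom_invE fmapM -compA.
have /= <- := naturality (unit a) g.
by rewrite compA triangle_r comp1m.
Qed.

Lemma trace_pairingE (A : lcat k) (Tr : forall x : A, {linear hom x x -> k^o})
    (x y : A) (f : hom x y) (g : hom y x) :
  trace_pairing Tr x y f g = Tr x (g ;o f).
Proof.
have lin1 (h : hom x y) : linear (fun u : hom y x => Tr x (u ;o h)).
  by move=> c u v; rewrite linearPl linearP.
rewrite linfunE; first by rewrite linfunE.
move=> c u v; apply/lfunP => w.
by rewrite lfunE /= lfunE /= !linfunE // linearPr linearP.
Qed.

Lemma dual_lfunE (U V : vectType k) (h : 'Hom(U, V)) (u : 'Hom(V, k^o)) :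
  dual_lfun h u = (u \o h)%VF.
Proof.
by rewrite linfunE // => c v w; rewrite comp_lfunDl comp_lfunZl.
Qed.

Lemma transposeE (A B : lcat k) (trA : trace A) (trB : trace B)
    (F : lfunctor A B) (Fs : lfunctor B A) (x : A) (y : B)
    (phi : 'Hom(hom (F x) y, hom x (Fs y))) (g : hom (Fs y) x) (f : hom (F x) y) :
  trB y (f ;o transpose trA trB phi g) = trA (Fs y) (phi f ;o g).
Proof.
rewrite -trace_pairingE /transpose !comp_lfunE dual_lfunE.
have [s' sK s'K] := Tr_nondegenerate trB y (F x).
rewrite -[X in (inv_lfun _) X]s'K.
rewrite lker0_lfunK; last by apply/lker0P; exact: can_inj sK.
by rewrite s'K comp_lfunE trace_pairingE.
Qed.

End Linearity.

(* Main.v *)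
From mathcomp Require Import all_boot all_order all_algebra.
From Stdlib Require Import FunctionalExtensionality ProofIrrelevance.
Require Import Defs.
Import GRing.Theory.
Local Open Scope ring_scope.
Local Open Scope lcat_scope.

(** Write phi for the adjunction isomorphism Hom(Fx,y) -> Hom(x,F*y).  Since
    the trace pairings are perfect, a morphism is determined by the traces of
    its composites with all morphisms going back, and any linear functional on
    those arises from a morphism.  So the two halves of the transposed
    adjunction can be prescribed by their traces: the unit eta'_y and the
    counit epsilon'_x are the morphisms with

      Tr (f eta'_y) = Tr (phi f)              for f : FF*y -> y,
      Tr (h epsilon'_x) = Tr (phi^-1 h)       for h : x -> F*Fx.

    Naturality of phi and cyclicity extend these to the two transposition
    rules (lemmas [trace_transpose] and [trace_transpose_inv])

      Tr (f (Fg eta'_y)) = Tr (phi f g)       for f : Fx -> y, g : F*y -> x,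
      Tr (u (epsilon'_x F*h)) = Tr (h phi^-1 u)   for u : x -> F*y, h : y -> Fx,

    the first of which says that g |-> Fg eta'_y is phi^t.  After pairing with
    an arbitrary morphism, each axiom of an adjunction and of an even-handed
    structure becomes an identity of traces, and the transposition rules move
    eta' and epsilon' out of it, leaving naturality or the fact that phi and
    phi^-1 are inverse to each other.  In particular Psi is an involution
    because the first rule, with f an identity, and cyclicity say that the unit
    eta = phi id has the traces that define the unit transposed from phi^t; and
    Psi respects composites because phi_GF = phi_F phi_G. *)

(** * Extensionality for adjunctions *)

Lemma nat_trans_ext {k : fieldType} {A B : lcat k} {F G : lfunctor A B}
    (s t : nat_trans F G) : (forall x, s x = t x) -> s = t.
Proof.
case: s t => [s ns] [t nt] /= est.
have {}est : s = t by apply: functional_extensionality_dep.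
by subst t; congr NatTrans; apply: proof_irrelevance.
Qed.

(** The unit determines the counit: both counits invert the same natural
    isomorphism [adj_hom], and the counit is the image of the identity under
    the inverse. *)
Lemma adj_ext {k : fieldType} {A B : lcat k} {F : lfunctor A B}
    {Fs : lfunctor B A} (a b : adj F Fs) :
  (forall x, unit a x = unit b x) -> a = b.
Proof.
move=> eu.
have ec y : counit a y = counit b y.
  have ei : adj_hom_inv a (Fs y) y (idm (Fs y))
            = adj_hom_inv b (Fs y) y (idm (Fs y)).
    by rewrite -[RHS](adj_homK a) adj_homE eu -adj_homE adj_hom_invK.
  by move: ei; rewrite !adj_hom_invE !fmap1 !compm1.
move: (nat_trans_ext _ _ eu) (nat_trans_ext _ _ ec).
case: a {eu ec} => [ua ca la ra]; case: b => [ub cb lb rb] /= eu ec.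
by subst ub cb; congr Adj; apply: proof_irrelevance.
Qed.

(** * Naturality of the adjunction isomorphism *)

Section AdjunctionNaturality.
Context {k : fieldType} {A B : lcat k} {F : lfunctor A B} {Fs : lfunctor B A}.
Variable a : adj F Fs.

Lemma adj_hom_compr (w x : A) (y : B) (f : hom (F x) y) (g : hom w x) :
  adj_hom a w y (f ;o fmap F g) = adj_hom a x y f ;o g.
Proof.
rewrite !adj_homE fmapM -!compA; congr (_ ;o _).
by have /= -> := naturality (unit a) g.
Qed.

Lemma adj_hom_compl (x : A) (y z : B) (m : hom y z) (f : hom (F x) y) :
  adj_hom a x z (m ;o f) = fmap Fs m ;o adj_hom a x y f.
Proof. by rewrite !adj_homE fmapM compA. Qed.

Lemma adj_hom_inv_compr (w x : A) (y : B) (u : hom x (Fs y)) (g : hom w x) :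
  adj_hom_inv a w y (u ;o g) = adj_hom_inv a x y u ;o fmap F g.
Proof. by rewrite !adj_hom_invE fmapM compA. Qed.

Lemma adj_hom_inv_compl (x : A) (y z : B) (m : hom y z) (u : hom x (Fs y)) :
  adj_hom_inv a x z (fmap Fs m ;o u) = m ;o adj_hom_inv a x y u.
Proof.
rewrite !adj_hom_invE fmapM !compA; congr (_ ;o _).
by have /= -> := naturality (counit a) m.
Qed.

End AdjunctionNaturality.

Lemma adj_hom_comp_adj {k : fieldType} {A B D : lcat k}
    {F : lfunctor A B} {Fs : lfunctor B A} (aF : adj F Fs)
    {G : lfunctor B D} {Gs : lfunctor D B} (aG : adj G Gs)
    (x : A) (z : D) (f : hom (G (F x)) z) :
  adj_hom (comp_adj aF aG) x z f
  = adj_hom aF x (Gs z) (adj_hom aG (F x) z f).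
Proof. by rewrite !adj_homE /= /comp_unit_fun fmapM compA. Qed.

(** * Morphisms prescribed by their traces *)

Section TraceDuality.
Context {k : fieldType} {A : lcat k}.
Variables (tr : trace A) (x y : A).

Lemma trace_ext (f f' : hom x y) :
  (forall g : hom y x, tr x (g ;o f) = tr x (g ;o f')) -> f = f'.
Proof.
move=> eff'; apply: (bij_inj (Tr_nondegenerate tr x y)).
by apply/lfunP => g; rewrite !trace_pairingE.
Qed.

Definition trace_repr (u : 'Hom(hom y x, k^o)) : hom x y :=
  ((trace_pairing tr x y)^-1)%VF u.

Lemma trace_reprE (u : 'Hom(hom y x, k^o)) (g : hom y x) :
  tr x (g ;o trace_repr u) = u g.
Proof.
have [s' sK s'K] := Tr_nondegenerate tr x y.
rewrite -trace_pairingE /trace_repr -[u in LHS]s'K.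
rewrite lker0_lfunK; last by apply/lker0P; exact: can_inj sK.
by rewrite s'K.
Qed.

End TraceDuality.

(** * The transposed adjunction *)

Section TransposeAdjunction.
Context {k : fieldType} {A B : lcat k}.
Variables (trA : trace A) (trB : trace B).
Context {F : lfunctor A B} {Fs : lfunctor B A}.
Variable a : adj F Fs.

Definition transpose_unit (y : B) : hom y (F (Fs y)) :=
  trace_repr trB y (F (Fs y))
    (linfun (trA (Fs y)) \o adj_hom a (Fs y) y)%VF.

Definition transpose_counit (x : A) : hom (Fs (F x)) x :=
  trace_repr trA (Fs (F x)) x
    (linfun (trB (F x)) \o adj_hom_inv a x (F x))%VF.

Lemma transpose_unitE (y : B) (f : hom (F (Fs y)) y) :
  trB y (f ;o transpose_unit y) = trA (Fs y) (adj_hom a (Fs y) y f).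
Proof. by rewrite trace_reprE comp_lfunE lfunE. Qed.

Lemma transpose_counitE (x : A) (h : hom x (Fs (F x))) :
  trA (Fs (F x)) (h ;o transpose_counit x)
  = trB (F x) (adj_hom_inv a x (F x) h).
Proof. by rewrite trace_reprE comp_lfunE lfunE. Qed.

Lemma trace_transpose (x : A) (y : B) (f : hom (F x) y) (g : hom (Fs y) x) :
  trB y (f ;o (fmap F g ;o transpose_unit y))
  = trA (Fs y) (adj_hom a x y f ;o g).
Proof. by rewrite compA transpose_unitE adj_hom_compr. Qed.

Lemma trace_transpose_inv (x : A) (y : B) (u : hom x (Fs y)) (h : hom y (F x)) :
  trA (Fs y) (u ;o (transpose_counit x ;o fmap Fs h))
  = trB (F x) (h ;o adj_hom_inv a x y u).
Proof.
by rewrite compA Tr_cyclic compA transpose_counitE adj_hom_inv_compl.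
Qed.

Lemma transpose_unit_natural (y z : B) (m : hom y z) :
  transpose_unit z ;o fmap (id_functor B) m
  = fmap (F \oF Fs) m ;o transpose_unit y.
Proof.
apply: (trace_ext trB) => f /=.
rewrite trace_transpose compA Tr_cyclic compA transpose_unitE.
by rewrite adj_hom_compl Tr_cyclic.
Qed.

Lemma transpose_counit_natural (w x : A) (m : hom w x) :
  transpose_counit x ;o fmap (Fs \oF F) m
  = fmap (id_functor A) m ;o transpose_counit w.
Proof.
apply: (trace_ext trA) => h /=.
rewrite trace_transpose_inv [in RHS]compA transpose_counitE adj_hom_inv_compr.
by rewrite Tr_cyclic.
Qed.

Lemma transpose_triangle_l (y : B) :
  transpose_counit (Fs y) ;o fmap Fs (transpose_unit y) = idm (Fs y).
Proof.
apply: (trace_ext trA) => u.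
by rewrite trace_transpose_inv Tr_cyclic transpose_unitE adj_hom_invK compm1.
Qed.

Lemma transpose_triangle_r (x : A) :
  fmap F (transpose_counit x) ;o transpose_unit (F x) = idm (F x).
Proof.
apply: (trace_ext trB) => f.
by rewrite trace_transpose transpose_counitE adj_homK compm1.
Qed.

Definition transpose_adj : adj Fs F :=
  {| unit := @NatTrans k B B (id_functor B) (F \oF Fs)
               transpose_unit transpose_unit_natural;
     counit := @NatTrans k A A (Fs \oF F) (id_functor A)
                 transpose_counit transpose_counit_natural;
     triangle_l := transpose_triangle_l;
     triangle_r := transpose_triangle_r |}.

Lemma adj_hom_transpose_adj (x : A) (y : B) :
  adj_hom transpose_adj y x = transpose trA trB (adj_hom a x y).
Proof.
apply/lfunP => g; apply: (trace_ext trB) => f.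
by rewrite transposeE adj_homE trace_transpose.
Qed.

End TransposeAdjunction.

(** * The even-handed axioms *)

Lemma transpose_adjK {k : fieldType} {A B : lcat k}
    (trA : trace A) (trB : trace B) {F : lfunctor A B} {Fs : lfunctor B A}
    (a : adj F Fs) :
  transpose_adj trB trA (transpose_adj trA trB a) = a.
Proof.
apply: adj_ext => x; apply: (trace_ext trA) => f.
rewrite transpose_unitE adj_homE /=.
(* Write the trace of phi' f as that of (id o phi' f), so that the
   transposition rule turns it into the trace of phi id o f = eta_x o f. *)
rewrite -[X in trB _ X = _]comp1m trace_transpose.
by rewrite adj_homE fmap1 comp1m Tr_cyclic.
Qed.

Lemma transpose_adj_id {k : fieldType} {A : lcat k} (tr : trace A) :
  transpose_adj tr tr (id_adj A) = id_adj A.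
Proof.
apply: adj_ext => x; apply: (trace_ext tr) => f.
by rewrite transpose_unitE adj_homE.
Qed.

Lemma transpose_adj_comp {k : fieldType} {A B D : lcat k}
    (trA : trace A) (trB : trace B) (trD : trace D)
    {F : lfunctor A B} {Fs : lfunctor B A} (aF : adj F Fs)
    {G : lfunctor B D} {Gs : lfunctor D B} (aG : adj G Gs) :
  transpose_adj trA trD (comp_adj aF aG)
  = comp_adj (transpose_adj trB trD aG) (transpose_adj trA trB aF).
Proof.
apply: adj_ext => z; apply: (trace_ext trD) => f.
rewrite transpose_unitE adj_hom_comp_adj /= /comp_unit_fun /=.
by rewrite trace_transpose transpose_unitE.
Qed.

(** Both sides are mates of theta: the left one is phi_F (epsilon_G theta), the
    right one is the inverse of phi_G^t applied to theta eta'_F.  Paired with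
    u : F*y -> G*y, each gives the trace of phi_F (phi_G^-1 u theta), since
    naturality of theta slides u from one side of theta to the other. *)
Lemma transpose_adj_mate {k : fieldType} {A B : lcat k}
    (trA : trace A) (trB : trace B)
    {F G : lfunctor A B} (theta : nat_trans F G)
    {Fs : lfunctor B A} (aF : adj F Fs)
    {Gs : lfunctor B A} (aG : adj G Gs) (y : B) :
  fmap Fs (counit aG y) ;o fmap Fs (theta (Gs y)) ;o unit aF (Gs y)
  = counit (transpose_adj trA trB aG) (Fs y) ;o fmap Gs (theta (Fs y))
      ;o fmap Gs (unit (transpose_adj trA trB aF) y).
Proof.
apply: (trace_ext trA (Gs y) (Fs y)) => u.
transitivity (trA (Gs y)
    (u ;o adj_hom aF (Gs y) y (counit aG y ;o theta (Gs y)))).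
  by rewrite adj_homE fmapM.
transitivity (trA (Gs y) (u ;o (transpose_counit trA trB aG (Fs y)
    ;o fmap Gs (theta (Fs y) ;o transpose_unit trA trB aF y)))); last first.
  by congr (trA _ (_ ;o _)); rewrite fmapM compA.
rewrite trace_transpose_inv [RHS]Tr_cyclic compA transpose_unitE adj_hom_invE.
by rewrite -compA -naturality compA adj_hom_compr Tr_cyclic.
Qed.

Theorem proposition5p12 (k : fieldType) (C : full_sub2cat k)
    (hC : ambidextrous C) (tr : forall A : ob2 C, trace A) :
  exists E : even_handed C,
    forall (A B : ob2 C) (F : lfunctor A B) (Fs : lfunctor B A) (a : adj F Fs)
           (x : A) (y : B),
      adj_hom (Psi E a) y x = transpose (tr A) (tr B) (adj_hom a x y).
Proof.
exists {| Psi := fun A B F Fs a => transpose_adj (tr A) (tr B) a;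
          PsiK := fun A B F Fs => transpose_adjK (tr A) (tr B);
          Psi_id := fun A => transpose_adj_id (tr A);
          Psi_comp := fun A B D F Fs aF G Gs aG =>
            transpose_adj_comp (tr A) (tr B) (tr D) aF aG;
          Psi_nat := fun A B F G theta Fs aF Gs aG =>
            transpose_adj_mate (tr A) (tr B) theta aF aG |}.
by move=> A B F Fs a x y; exact: adj_hom_transpose_adj.
Qed.
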